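(* Let $\Lambda:\mathbb{R}^2\to(-\infty,\infty]$ be the function defined in the context (which is finite in a neighborhood of the origin $(\alpha_1,\alpha_2)=(0,0)$), and let $\Lambda^*$ be defined by $$\Lambda^*(z_1,z_2):=\sup_{(\alpha_1,\alpha_2)\in\mathbb{R}^2}\{\alpha_1z_1+\alpha_2z_2-\Lambda(\alpha_1,\alpha_2)\}.$$ Then $$\limsup_{x\to\infty}\frac{1}{x}\log P\left(\left(\frac{\tau(x)}{x},\frac{A(x)}{x^2}\right)\in C\right)\leq-\inf_{(z_1,z_2)\in C}\Lambda^*(z_1,z_2)\quad\text{for all closed sets } C\subset\mathbb{R}^2,$$ and $$\liminf_{x\to\infty}\frac{1}{x}\log P\left(\left(\frac{\tau(x)}{x},\frac{A(x)}{x^2}\right)\in O\right)\geq-\inf_{(z_1,z_2)\in O\cap\mathcal{E}}\Lambda^*(z_1,z_2)\quad\text{for all open sets } O\subset\mathbb{R}^2,$$ where $\mathcal{E}$ is the set of exposed points of $\Lambda^*$.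
   Context: Let $\{T_n:n\geq 1\}$ be i.i.d. (strictly) positive random variables on a probability space $(\Omega,\mathcal{F},P)$, and define $\varphi:\mathbb{R}\to(-\infty,\infty]$ by $\mathbb{E}[e^{\alpha T_n}]=e^{\varphi(\alpha)}$. Let $\mathcal{D}(\varphi):=\{\alpha\in\mathbb{R}:\varphi(\alpha)<\infty\}$. It is assumed throughout that $0$ belongs to the interior of $\mathcal{D}(\varphi)$; hence either $\mathcal{D}(\varphi)=\mathbb{R}$, or $\mathcal{D}(\varphi)=(-\infty,\bar{\alpha})$ or $\mathcal{D}(\varphi)=(-\infty,\bar{\alpha}]$ for some $\bar{\alpha}>0$. Let $N(t):=\sum_{n\geq 1}1_{\{T_1+\cdots+T_n\leq t\}}$, $t\geq 0$, be the associated renewal process. For real $x>0$ define $$\tau(x):=\inf\{t\geq 0:x-N(t)\leq 0\},\qquad A(x):=\int_0^{\tau(x)}(x-N(t))\,dt.$$ Limits as $x\to\infty$ are taken over real $x>0$. Definition of $\Lambda$: if $\mathcal{D}(\varphi)=\mathbb{R}$, then $\Lambda(\alpha_1,\alpha_2):=\int_0^1\varphi(\alpha_1+\alpha_2y)\,dy$ for all $(\alpha_1,\alpha_2)\in\mathbb{R}^2$. If $\mathcal{D}(\varphi)=(-\infty,\bar{\alpha})$ or $\mathcal{D}(\varphi)=(-\infty,\bar{\alpha}]$ for some $\bar{\alpha}>0$, then $$\Lambda(\alpha_1,\alpha_2):=\begin{cases}\int_0^1\varphi(\alpha_1+\alpha_2y)\,dy&\text{if }(\alpha_1,\alpha_2)\in\mathcal{D}\\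 \infty&\text{otherwise,}\end{cases}$$ where $$\mathcal{D}:=\{(\alpha_1,\alpha_2)\in\mathbb{R}^2:\alpha_2\geq 0,\ \alpha_1+\alpha_2\in\mathcal{D}(\varphi)\}\cup\{(\alpha_1,\alpha_2)\in\mathbb{R}^2:\alpha_2<0,\ \alpha_1\leq\bar{\alpha}\}$$ (the integral may be $+\infty$). A point $w\in\mathbb{R}^2$ is an exposed point of $\Lambda^*$ if there is $\alpha\in\mathbb{R}^2$ such that $\langle\alpha,w\rangle-\Lambda^*(w)>\langle\alpha,z\rangle-\Lambda^*(z)$ for all $z\in\mathbb{R}^2$, $z\neq w$, where $\langle\cdot,\cdot\rangle$ is the Euclidean inner product. Conventions: $\log 0=-\infty$, $\inf\emptyset=+\infty$. *)

(* Defs.v *)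
From HB Require Import structures.
From mathcomp Require Import all_boot all_order all_algebra.
From mathcomp Require Import all_classical all_reals all_analysis.

Set Implicit Arguments.
Unset Strict Implicit.
Unset Printing Implicit Defensive.

Import Order.TTheory GRing.Theory Num.Theory.
Import numFieldNormedType.Exports.

Local Open Scope classical_set_scope.
Local Open Scope ring_scope.

Section renewal.
Context d (Omega : measurableType d) (R : realType) (P : probability Omega R).

Definition mutually_independent (T : nat -> Omega -> R) : Prop :=
  forall (s : seq nat) (B : nat -> set R), uniq s ->
    (forall i, i \in s -> measurable (B i)) ->
    P (\bigcap_(i in [set` s]) (T i @^-1` B i)) =
    (\prod_(i <- s) P (T i @^-1` B i))%E.

Definition identically_distributed (T : nat -> Omega -> R) : Prop :=
  forall (m n : nat) (B : set R), measurable B ->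
    P (T m @^-1` B) = P (T n @^-1` B).

(* Sequences are indexed from 0: T_1, T_2, ... is T 0, T 1, ..., so that
   S n = T_1 + ... + T_n and S 0 = 0. *)
Definition partial_sum (T : nat -> Omega -> R) (n : nat) (w : Omega) : R :=
  \sum_(i < n) T i w.

(* Extended-real valued, since infinitely many partial sums may lie below t on
   some (negligible) set of outcomes. *)
Definition renewal (T : nat -> Omega -> R) (t : R) (w : Omega) : \bar R :=
  (\sum_(1 <= n <oo) (\1_[set u | (partial_sum T n u <= t)%R] w)%:E)%E.

(* A real infimum: the set is never empty, as max(0, S 1, ..., S n) belongs
   to it for every n >= x. *)
Definition hitting_time (T : nat -> Omega -> R) (x : R) (w : Omega) : R :=
  inf [set t : R | 0 <= t /\ (x%:E - renewal T t w <= 0)%E].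

(* The integrand lies in ]0, x] on [0, tau(x)[, so the integral is finite. *)
Definition swept_area (T : nat -> Omega -> R) (x : R) (w : Omega) : R :=
  fine (\int[@lebesgue_measure R]_(t in `[0%R, hitting_time T x w])
          (x%:E - renewal T t w))%E.

Definition scaled_pair (T : nat -> Omega -> R) (x : R) (w : Omega) : R * R :=
  (hitting_time T x w / x, swept_area T x w / x ^+ 2).

(* lne is log on [0, +oo], with lne 0 = -oo and lne +oo = +oo. *)
Definition phi (X : Omega -> R) (alpha : R) : \bar R := lne ('M_P X alpha).

End renewal.

Section rate.
Context (R : realType).
Local Open Scope ereal_scope.

Definition effective_domain (f : R -> \bar R) : set R :=
  [set alpha | f alpha < +oo].

(* When D(f) is ]-oo, b[ or ]-oo, b], the bound b is sup D(f). *)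
Definition Lambda_domain (f : R -> \bar R) : set (R * R) :=
  [set a | (0 <= a.2)%R /\ effective_domain f (a.1 + a.2)%R] `|`
  [set a | (a.2 < 0)%R /\ (a.1 <= sup (effective_domain f))%R].

Definition Lambda (f : R -> \bar R) (a : R * R) : \bar R :=
  let I := \int[@lebesgue_measure R]_(y in `[0%R, 1%R]) f (a.1 + a.2 * y)%R in
  if `[< effective_domain f = setT >] then I
  else if `[< Lambda_domain f a >] then I
  else +oo.

Definition dotp (a z : R * R) : R := (a.1 * z.1 + a.2 * z.2)%R.

Definition conjugate (L : R * R -> \bar R) (z : R * R) : \bar R :=
  ereal_sup [set (dotp a z)%:E - L a | a in setT].

Definition exposed_points (J : R * R -> \bar R) : set (R * R) :=
  [set w | exists a : R * R, forall z : R * R, z <> w ->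
     (dotp a z)%:E - J z < (dotp a w)%:E - J w].

End rate.

(* Main.v *)
Require Import Defs.
From HB Require Import structures.
From mathcomp Require Import all_boot all_order all_algebra.
From mathcomp Require Import all_classical all_reals all_analysis.
From mathcomp Require Import measurable_realfun ring lra.

Set Implicit Arguments.
Unset Strict Implicit.
Unset Printing Implicit Defensive.

Import Order.TTheory GRing.Theory Num.Theory.
Import numFieldNormedType.Exports.

Local Open Scope classical_set_scope.
Local Open Scope ring_scope.

(** The hitting time and the swept area are weighted sums of the steps. For
    [n < x <= n + 1] the process reaches level [x] at its jump number [n + 1],
    so [tau(x) = T_1 + .. + T_(n+1)], and summation by parts gives
    [A(x) = \sum_(k <= n) (x - k) T_(k+1)]. Hence for a dual vector [b] the
    exponential moment of order [x b] of [(tau(x)/x, A(x)/x^2)] is a product,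
    and its logarithm is [\sum_(k <= n) phi (b_1 + b_2 (1 - k/x))]. As [phi]
    is monotone, this is a Riemann sum whose distance to [x * Lambda b] is
    bounded uniformly in [x]. This holds on the [core] of the domain of
    [Lambda], which plays the role of its interior ([mgf_scaled_pair]).

    The rest is the Gaertner-Ellis argument, made explicit by the shape of the
    domain.

    The core determines [Lambda^*] ([conjugate_gt_core]): moving [b_1] to the
    left sends any point of the domain into the core and only decreases
    [Lambda], because [phi] is nondecreasing.

    A vector [a] that exposes a point of [Lambda^*] lies in the core
    ([exposing_core]): otherwise the domain is on one side of a line through
    [a] orthogonal to [v = (1, 0)] or [v = (1, 1)], and going from [w] to
    [w + v] increases [Lambda^*] by at most [<a, v>], so the maximum at [w] is
    not strict.

    Weighted exponential bound ([tilted_closed_bound]). Fix [a] in the core.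
    If every point of a closed set [C] belongs to an open half-plane on which
    [<b, z> - Lambda b] exceeds [<a, z> - Lambda a + l] for some [b] in the
    core, then finitely many of these half-planes cover the part of [C] where
    the pair lives: a compact piece by compactness, and the rest by a single
    half-plane with [b = a + (e, 0)], since [A(x)/x^2 <= tau(x)/x]. Chernoff's
    bound on each of them controls the integral of [exp (x <a, Z>)] over the
    event [Z \in C] by a constant times [exp (x (Lambda a - l - e))].

    With [a = 0] this is the upper bound. For the lower bound at an exposed
    point [w], take for [a] the exposing vector, for [C] the complement of a
    small ball around [w] and [l = 0]: the exponential moment of order [x a]
    then concentrates on the ball, where its density is at most about
    [exp (x <a, w>)], so that the probability of the ball is at least about
    [exp (x (Lambda a - <a, w>))], and [<a, w> - Lambda a <= Lambda^* w]. *)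

(** * Expectation of a product of independent factors *)

Section independence.
Context d (Omega : measurableType d) (R : realType) (P : probability Omega R).
Local Open Scope ereal_scope.

Import HBNNSimple.

(** Linearity extends a product rule for indicators of [X] to simple functions
    of [X]; it is stated for a general weight [g] so that it applies to
    partial products, and to the constant weight. *)
Lemma integral_mul_nnsfun (g : Omega -> R) (X : Omega -> R) (c : R)
    (h : {nnsfun R >-> R}) :
  (forall w, 0 <= g w)%R -> measurable_fun setT g ->
  measurable_fun setT X -> (0 <= c)%R ->
  (forall B, measurable B ->
    \int[P]_(w in X @^-1` B) (g w)%:E = c%:E * P (X @^-1` B)) ->
  \int[P]_w (g w * h (X w))%:E =
    c%:E * \sum_(r \in range h) (r%:E * P (X @^-1` (h @^-1` [set r]))).
Proof.
move=> g0 mg mX c0 gX.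
have mXh r : measurable (X @^-1` (h @^-1` [set r])).
  by rewrite -[_ @^-1` _]setTI; apply: mX.
under eq_integral => w _ do
  (rewrite (fimfunE h) mulr_fsumr // -fsumEFin //).
rewrite ge0_integral_fsum//; last 2 first.
- move=> r; apply/measurable_EFinP; apply: measurable_funM => //.
  apply: measurable_funM => //.
  rewrite (_ : (fun _ => _) = \1_(X @^-1` (h @^-1` [set r]))); last first.
    by apply/funext => w; rewrite !indicE; congr ((_ : bool)%:R);
      apply/idP/idP; rewrite !inE.
  exact: measurable_indic.
- move=> r w _; rewrite lee_fin mulr_ge0// .
  by have := nnfun_muleindic_ge0 h r (X w); rewrite -EFinM lee_fin.
rewrite ge0_mule_fsumr; last first.
  move=> r; rewrite (mulemu_ge0 (fun r => X @^-1` (h @^-1` [set r])))// => r0.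
  by rewrite preimage_nnfun0// preimage_set0.
apply: eq_fsbigr => r; rewrite inE => -[y _ <-{r}].
rewrite muleCA -gX// [in RHS]integral_mkcond -ge0_integralZl_EFin//; last 2 first.
- move=> w _; rewrite /patch; case: ifP => // _; by rewrite lee_fin.
- apply/(measurable_restrictT _ _).1 => //.
  by apply/measurable_EFinP; exact: measurable_funTS.
apply: eq_integral => w _; rewrite patchE indicE.
have -> : (X w \in h @^-1` [set h y]) = (w \in X @^-1` (h @^-1` [set h y])).
  by apply/idP/idP; rewrite !inE.
by case: ifP => _; rewrite ?mulr1 ?mulr0 ?mule0 // mulrC.
Qed.

(** Passage to the limit in [integral_mul_nnsfun] along an increasing sequence
    of simple functions. *)
Lemma integral_mul_comp (g : Omega -> R) (X : Omega -> R) (c : R) (f : R -> R) :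
  (forall w, 0 <= g w)%R -> measurable_fun setT g ->
  measurable_fun setT X -> (0 <= c)%R ->
  (forall B, measurable B ->
    \int[P]_(w in X @^-1` B) (g w)%:E = c%:E * P (X @^-1` B)) ->
  measurable_fun setT f -> (forall y, 0 <= f y)%R ->
  \int[P]_w (g w * f (X w))%:E = c%:E * \int[P]_w (f (X w))%:E.
Proof.
move=> g0 mg mX c0 gX mf f0.
have mf' : measurable_fun setT (EFin \o f) by apply/measurable_EFinP.
pose f_ := nnsfun_approx measurableT mf'.
have cvg_f (k : Omega -> R) : (forall w, 0 <= k w)%R -> measurable_fun setT k ->
    \int[P]_w (k w * f_ n (X w))%:E @[n --> \oo] --> \int[P]_w (k w * f (X w))%:E.
  move=> k0 mk.
  have -> : \int[P]_w (k w * f (X w))%:E =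
      \int[P]_w limn (fun n => (k w * f_ n (X w))%:E).
    apply: eq_integral => w _; apply/esym/cvg_lim => //.
    under eq_fun do rewrite EFinM.
    rewrite EFinM; apply: cvgeZl => //.
    by apply: (cvg_nnsfun_approx measurableT mf') => // x _; rewrite lee_fin.
  apply: cvg_monotone_convergence => //.
  - move=> n; apply/measurable_EFinP; apply: measurable_funM => //.
    exact: measurableT_comp.
  - by move=> n w _; rewrite lee_fin mulr_ge0.
  - move=> w _ m n mn; rewrite lee_fin ler_wpM2l//.
    exact/lefP/nd_nnsfun_approx.
have h1 := cvg_f g g0 mg.
have h2 := cvg_f (cst 1%R) (fun=> ler01) (measurable_cst _).
have {h2} := cvgeZl (erefl : c%:E \is a fin_num) h2.
have -> : (fun n => c%:E * \int[P]_w (cst 1%R w * f_ n (X w))%:E) =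
    (fun n => \int[P]_w (g w * f_ n (X w))%:E).
  apply/funext => n.
  rewrite (@integral_mul_nnsfun g X c (f_ n))//.
  rewrite (@integral_mul_nnsfun (cst 1%R) X 1%R (f_ n))//.
    by rewrite mul1e.
  move=> B mB; rewrite /= (integral_cst _ _ 1)//; last first.
    by rewrite -[_ @^-1` _]setTI; apply: mX.
move=> h2; have := cvg_unique _ h1 h2 => -> //.
by under eq_integral do rewrite mul1r.
Qed.

(** The factors are replaced one at a time: an indicator of [T n] becomes the
    function [f n] of [T n] by [integral_mul_comp], the weight being the
    product of the functions already in place and of the indicators still to
    be treated. *)
Lemma integral_prod_indep (T : nat -> {RV P >-> R}) (f : nat -> R -> R)
    (c : nat -> R) (n : nat) :
  mutually_independent P T ->
  (forall i, measurable_fun setT (f i)) -> (forall i y, 0 <= f i y)%R ->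
  (forall i, (i < n)%N -> \int[P]_w (f i (T i w))%:E = (c i)%:E) ->
  \int[P]_w (\prod_(i < n) f i (T i w))%:E = (\prod_(i < n) c i)%:E.
Proof.
move=> T_indep mf f0.
have mT i (B : set R) : measurable B -> measurable (T i @^-1` B).
  by move=> mB; rewrite -[_ @^-1` _]setTI; apply: measurable_funPT.
(* The induction on [n] needs indicators of the later variables. *)
suff H : (forall i, (i < n)%N -> \int[P]_w (f i (T i w))%:E = (c i)%:E) ->
    forall (s : seq nat) (B : nat -> set R), uniq s ->
    (forall i, i \in s -> (n <= i)%N) -> (forall i, measurable (B i)) ->
    \int[P]_(w in \bigcap_(i in [set` s]) (T i @^-1` B i))
      (\prod_(i < n) f i (T i w))%:E =
    (\prod_(i < n) c i)%:E * \prod_(i <- s) P (T i @^-1` B i).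
  move=> Efc; have := H Efc [::] (fun=> setT) erefl.
  rewrite big_nil mule1 => <- //; congr (integral _ _ _).
  by rewrite set_nil bigcap_set0.
elim: n => [_|n IH Efc] s B us sn mB.
  rewrite big_ord0 mul1e -T_indep//.
  under eq_integral do rewrite big_ord0.
  rewrite integral_cst ?mul1e//.
  by apply: fin_bigcap_measurable => // i _; exact: mT.
have c0 i : (i < n.+1)%N -> (0 <= c i)%R.
  by move=> ni; rewrite -lee_fin -Efc// integral_ge0// => w _; rewrite lee_fin.
have Ifin : (\prod_(i <- s) P (T i @^-1` B i)) \is a fin_num.
  apply: (big_ind (fun x : \bar R => x \is a fin_num)) => // [x y|i _].
    exact: fin_numM.
  exact/fin_num_measure/mT.
have mI (s' : seq nat) (B' : nat -> set R) : (forall i, measurable (B' i)) ->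
    measurable (\bigcap_(i in [set` s']) (T i @^-1` B' i)).
  by move=> mB'; apply: fin_bigcap_measurable => // i _; exact: mT.
pose A := \bigcap_(i in [set` s]) (T i @^-1` B i).
have mA : measurable A by exact: mI.
pose g w := ((\prod_(i < n) f i (T i w)) * \1_A w)%R.
have mprod k : measurable_fun setT (fun w => \prod_(i < k) f i (T i w))%R.
  by apply: measurable_prod => i _; exact: measurableT_comp.
have prod0 k w : (0 <= \prod_(i < k) f i (T i w))%R by apply: prodr_ge0.
rewrite integral_mkcond.
transitivity (\int[P]_w (g w * f n (T n w))%:E).
  apply: eq_integral => w _; rewrite patchE /g big_ord_recr/= indicE -/A.
  by case: ifP => _; rewrite ?mulr1 // mulr0 mul0r.
rewrite (integral_mul_comp
  (c := (\prod_(i < n) c i)%R * fine (\prod_(i <- s) P (T i @^-1` B i))))//.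
- rewrite Efc// big_ord_recr/= !EFinM fineK//.
  by rewrite -!muleA; congr (_ * _); rewrite muleC.
- by move=> w; rewrite mulr_ge0.
- by apply: measurable_funM.
- rewrite mulr_ge0//; first by apply: prodr_ge0 => i _; exact/c0/leqW.
  by rewrite fine_ge0// prode_ge0.
move=> C mC.
pose B' i := if i == n then C else B i.
have nins : n \notin s by apply/negP => /sn; rewrite ltnn.
have eqB i : i \in s -> B' i = B i.
  by move=> si; rewrite /B'; case: eqP => // ni; rewrite -ni si in nins.
(* Against an indicator of [T n], the new weight is an instance of the
   induction hypothesis with [n] added to the list of indices. *)
have := IH (fun i ni => Efc i (leqW ni)) (n :: s) B'.
rewrite /= nins us => /(_ erefl).
have -> : \prod_(i <- n :: s) P (T i @^-1` B' i) =
    (fine (\prod_(i <- s) P (T i @^-1` B i)))%:E * P (T n @^-1` C).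
  rewrite fineK// big_cons muleC; congr (_ * _); last by rewrite /B' eqxx.
  by apply: eq_big_seq => i /eqB ->.
rewrite muleA -EFinM => <-.
- have -> : \bigcap_(i in [set` n :: s]) (T i @^-1` B' i) = T n @^-1` C `&` A.
    apply/seteqP; split=> [w Bw|w [Cw Aw] i /=].
    - split; first by have := Bw n; rewrite /B' eqxx; apply; rewrite /= mem_head.
      move=> i /= si; rewrite -eqB//; apply: Bw => /=.
      by rewrite inE si orbT.
    - rewrite inE => /orP[/eqP ->|si]; first by rewrite /B' eqxx.
      by rewrite eqB//; exact: Aw.
  rewrite integral_mkcondr; apply: eq_integral => w _.
  by rewrite patchE /g indicE; case: ifP => _; rewrite ?mulr1 ?mulr0.
- by move=> i; rewrite inE => /orP[/eqP ->//|/sn/ltnW].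
- by move=> i; rewrite /B'; case: ifP.
Qed.

End independence.

(** * The hitting time and the swept area along a path *)

Section renewal_path.
Context d (Omega : measurableType d) (R : realType).
Context (T : nat -> Omega -> R) (w : Omega).
Hypothesis T_gt0 : forall n, 0 < T n w.
Local Notation mu := (@lebesgue_measure R).
Local Notation S n := (partial_sum T n w).

Lemma partial_sumS n : S n.+1 = S n + T n w.
Proof. by rewrite /partial_sum big_ord_recr. Qed.

Lemma partial_sum_ge0 n : 0 <= S n.
Proof. by apply: sumr_ge0 => i _; exact: ltW. Qed.

Lemma partial_sum_le m n : (m <= n)%N -> S m <= S n.
Proof.
move=> /subnK <-; elim: (n - m)%N => // k IH.
by rewrite addSn partial_sumS (le_trans IH)// lerDl ltW.
Qed.

Lemma renewal_eq_sum t n : t < S n.+1 ->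
  renewal T t w = (\sum_(k < n) \1_(`[S k.+1, +oo[) t)%:E.
Proof.
move=> tS; rewrite /renewal (@nneseries_split _ _ 1 n)//.
rewrite eseries0 ?adde0; last first.
  move=> k; rewrite add1n => nk _; rewrite indicE memNset//=.
  by apply/negP; rewrite -ltNge (lt_le_trans tS)// partial_sum_le.
rewrite sumEFin big_add1 add1n /= big_mkord; congr (_%:E).
apply: eq_bigr => k _; rewrite !indicE; congr (_%:R); congr nat_of_bool.
by apply/idP/idP; rewrite !inE/= in_itv/= andbT.
Qed.

Lemma renewal_ge t n : S n <= t -> (n%:R%:E <= renewal T t w)%E.
Proof.
move=> St; apply: le_trans (nneseries_lim_ge n.+1 _) => //.
rewrite (eq_big_nat _ _ (F2 := fun=> 1%:E)).
  by rewrite sumEFin big_const_nat subSS subn0 iter_addr_0 lee_fin.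
move=> k /andP[k1 kn]; rewrite indicE mem_set//=.
by rewrite (le_trans _ St)// partial_sum_le.
Qed.

Lemma sum_indic_le (n : nat) (A : nat -> set R) t :
  \sum_(k < n) \1_(A k) t <= n%:R :> R.
Proof.
have -> : n%:R = \sum_(k < n) 1 :> R by rewrite sumr_const card_ord.
apply: ler_sum => k _.
by rewrite indicE lern1 leq_b1.
Qed.

(** Level [x] is reached exactly when the jump number [n + 1] occurs: before
    it at most [n < x] jumps have occurred, from it on at least
    [n + 1 >= x]. *)
Lemma hitting_time_eq x n : n%:R < x -> x <= n.+1%:R ->
  hitting_time T x w = S n.+1.
Proof.
move=> nx xn; rewrite /hitting_time.
transitivity (inf `[S n.+1, +oo[%classic); last by rewrite inf_itv.
congr inf; apply/seteqP; split=> t /=; rewrite in_itv/= andbT.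
- move=> [_ tx]; rewrite leNgt; apply/negP => tS.
  move: tx; apply/negP; rewrite sube_le0 -ltNge (renewal_eq_sum tS) lte_fin.
  apply: le_lt_trans nx.
  exact: (sum_indic_le n (fun k => `[S k.+1, +oo[%classic)).
- move=> St; split; first exact: le_trans (partial_sum_ge0 _) St.
  by rewrite sube_le0 (le_trans _ (renewal_ge St))// lee_fin.
Qed.

Lemma summation_by_parts (x : R) n :
  x * S n - \sum_(k < n) (S n - S k.+1) = \sum_(k < n) (x - k%:R) * T k w.
Proof.
elim: n => [|n IH]; first by rewrite !big_ord0 /partial_sum big_ord0 mulr0 subr0.
rewrite [RHS]big_ord_recr/= -IH [in LHS]big_ord_recr/= subrr addr0 partial_sumS.
rewrite (eq_bigr (fun k : 'I_n => (S n - S k.+1) + T n w)); last first.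
  by move=> k _; rewrite addrAC.
by rewrite big_split/= sumr_const card_ord -mulr_natl; ring.
Qed.

(** The whole interval of integration lies before the jump number [n + 2], so
    the integrand is [x] minus a sum of [n + 1] indicators, and its integral
    is the left-hand side of [summation_by_parts]. Including the jump
    number [n + 1] makes the formula valid at the right end point too. *)
Lemma swept_area_eq x n : n%:R < x -> x <= n.+1%:R ->
  swept_area T x w = \sum_(k < n.+1) (x - k%:R) * T k w.
Proof.
move=> nx xn; rewrite /swept_area (hitting_time_eq nx xn) -summation_by_parts.
have S0 := partial_sum_ge0 n.+1.
have muI (a b : R) : a <= b -> mu `[a, b]%classic = (b - a)%:E.
  rewrite lebesgue_measure_itv/= lte_fin; case: ltgtP => // -> _.
  by rewrite subrr.
have muS : mu `[0%R, S n.+1]%classic = (S n.+1)%:E by rewrite muI// subr0.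
pose h t : R := \sum_(k < n.+1) \1_(`[S k.+1, +oo[) t.
have mh : measurable_fun setT h.
  by apply: measurable_sum => k; exact: measurable_indic.
have fmu : (mu `[0%R, S n.+1]%classic < +oo)%E by rewrite muS ltry.
transitivity (fine (\int[mu]_(t in `[0%R, S n.+1]) (x%:E - (h t)%:E))%E).
  congr fine; apply: eq_integral => t; rewrite inE/= in_itv/= => /andP[_ tS].
  rewrite (@renewal_eq_sum _ n.+1)//.
  by rewrite (le_lt_trans tS)// [in ltRHS]partial_sumS ltrDl.
rewrite integralB_EFin//; last 2 first.
- apply: measurable_bounded_integrable => //.
  by exists `|x|; split; [exact: num_real|move=> N rN y _; exact: ltW].
- apply: measurable_bounded_integrable => //; first exact: measurable_funTS.
  exists n.+1%:R; split; [exact: num_real|move=> N rN y _].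
  rewrite /= ger0_norm; last by apply: sumr_ge0.
  rewrite (le_trans _ (ltW rN))//.
  exact: (sum_indic_le n.+1 (fun k => `[S k.+1, +oo[%classic)).
rewrite (integral_cst _ _ x%:E)//= muS.
have -> : (\int[mu]_(t in `[0%R, S n.+1]) (h t)%:E =
    (\sum_(k < n.+1) (S n.+1 - S k.+1))%:E)%E.
  under eq_integral do rewrite -sumEFin.
  rewrite ge0_integral_sum//; last first.
    by move=> k; apply/measurable_EFinP/measurable_funTS; exact: measurable_indic.
  rewrite -sumEFin; apply: eq_bigr => k _.
  rewrite integral_indic//.
  have -> : `[S k.+1, +oo[%classic `&` `[0, S n.+1]%classic =
      `[S k.+1, S n.+1]%classic.
    apply/seteqP; split=> t /=; rewrite !in_itv/= ?andbT.
      by move=> [-> /andP[_ ->]].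
    move=> /andP[a b]; rewrite a b; split=> //; rewrite andbT.
    exact: le_trans (partial_sum_ge0 _) a.
  exact/muI/partial_sum_le/ltn_ord.
by rewrite -EFinM -EFinB/=.
Qed.

End renewal_path.

(** * Riemann sums of monotone functions *)

Section riemann_sums.
Context (R : realType).
Local Notation mu := (@lebesgue_measure R).

Lemma Rintegral_increment_bounds (g : R -> R) (lo hi s t M : R) :
  measurable_fun setT g -> (forall y, 0 <= y <= 1 -> `|g y| <= M) ->
  0 <= t -> t <= s -> s <= 1 ->
  (forall y, t <= y <= s -> lo <= g y <= hi) ->
  (s - t) * lo <=
    \int[mu]_(y in `[0, s]) g y - \int[mu]_(y in `[0, t]) g y <= (s - t) * hi.
Proof.
move=> mg gM t0 ts s1 gts.
have mu01 : (mu `[0%R, 1%R]%classic < +oo)%E.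
  by rewrite lebesgue_measure_itv/=; case: ifP => _; rewrite -?EFinB ?ltry.
have g01 : mu.-integrable `[0%R, 1%R]%classic (EFin \o g).
  apply: measurable_bounded_integrable => //.
  - exact: measurable_funS mg.
  - exists M; split; first exact: num_real.
    by move=> N MN y /=; rewrite in_itv/= => /gM/le_trans; apply; exact: ltW.
have ig (i : interval R) : [set` i] `<=` `[0%R, 1%R]%classic ->
    mu.-integrable [set` i] (EFin \o g).
  by move=> i01; apply: integrableS g01.
have sub01 (a b : itv_bound R) : (BLeft 0 <= a)%O -> (b <= BRight 1)%O ->
    [set` Interval a b] `<=` `[0, 1]%classic.
  by move=> a0 b1; apply: subset_itv.
rewrite Rintegral_itvB//; last first.
  by apply: ig; apply: sub01; rewrite ?bnd_simp.
have sts : [set` `]t, s]] `<=` `[0, 1]%classic by apply: sub01; rewrite ?bnd_simp.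
have len : fine (mu `]t, s]%classic) = s - t.
  rewrite lebesgue_measure_itv/= lte_fin; case: ltgtP ts => // -> _.
  by rewrite subrr.
have int_cst (r : R) : mu.-integrable `]t, s] (EFin \o cst r).
  have c01 : mu.-integrable `[0%R, 1%R]%classic (EFin \o cst r).
    apply: measurable_bounded_integrable => //.
    by exists `|r|; split; [exact: num_real|move=> N rN y _; exact: ltW].
  by apply: integrableS c01.
have csts (r : R) : \int[mu]_(y in `]t, s]) (cst r y) = (s - t) * r.
  by rewrite /= Rintegral_cst// len mulrC.
apply/andP; split.
- rewrite -(csts lo); apply: le_Rintegral => //; first exact: ig.
  move=> y /=; rewrite in_itv/= => /andP[ty ys].
  by have /andP[] := gts y (introT andP (conj (ltW ty) ys)).
- rewrite -(csts hi); apply: le_Rintegral => //; first exact: ig.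
  move=> y /=; rewrite in_itv/= => /andP[ty ys].
  by have /andP[] := gts y (introT andP (conj (ltW ty) ys)).
Qed.

(** [F] is an antiderivative of [g], seen only through the bounds on its
    increments: this makes the statement symmetric under a change of sign of
    both functions, hence usable for decreasing functions as well. On each
    step of length [1/x] the error is at most the variation of [g], and these
    telescope; the last, incomplete step next to [0] is estimated
    directly. *)
Lemma monotone_sum_increments (g F : R -> R) (x : R) (n : nat) :
  0 < x -> n%:R < x -> x <= n.+1%:R ->
  (forall s t, 0 <= t -> t <= s -> s <= 1 -> g t <= g s) ->
  (forall s t, 0 <= t -> t <= s -> s <= 1 ->
    (s - t) * g t <= F s - F t <= (s - t) * g s) ->
  `|\sum_(k < n.+1) g (1 - k%:R / x) - x * (F 1 - F 0)| <= `|g 0| + `|g 1|.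
Proof.
move=> x0 nx xn g_nd gF.
pose y (k : nat) : R := 1 - k%:R / x.
have y1 k : y k <= 1 by rewrite /y lerBlDr lerDl divr_ge0// ltW.
have yS k : y k.+1 <= y k.
  by rewrite /y lerD2l lerN2 ler_pM2r ?invr_gt0// ler_nat.
have y0 k : (k <= n)%N -> 0 <= y k.
  move=> kn; rewrite /y subr_ge0 ler_pdivrMr// mul1r.
  by rewrite (le_trans _ (ltW nx))// ler_nat.
have x_y k : x * (y k - y k.+1) = 1.
  rewrite /y opprB addrC addrA subrK -mulrBl mulrC -mulrA mulVf ?gt_eqF//.
  by rewrite mulr1 -natrB// subSnn.
have gFx t s : 0 <= t -> t <= s -> s <= 1 ->
    x * (s - t) * g t <= x * (F s - F t) <= x * (s - t) * g s.
  by move=> t0 ts s1; rewrite -!mulrA !ler_pM2l//; exact: gF.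
have H k : (k <= n)%N ->
    0 <= \sum_(j < k) g (y j) - x * (F 1 - F (y k)) <= g 1 - g (y k).
  elim: k => [_|k IH kn].
    by rewrite big_ord0 /y mul0r subr0 !subrr mulr0 subrr lexx.
  have /andP[IH1 IH2] := IH (ltnW kn).
  have /andP[] := gFx _ _ (y0 _ kn) (yS k) (y1 k).
  rewrite !x_y !mul1r big_ord_recr/= => h1 h2.
  have -> : \sum_(i < k) g (y i) + g (y k) - x * (F 1 - F (y k.+1)) =
    (\sum_(i < k) g (y i) - x * (F 1 - F (y k))) +
      (g (y k) - x * (F (y k) - F (y k.+1))) by ring.
  by apply/andP; split; lra.
have /andP[H1 H2] := H n (leqnn n).
have /andP[] := gFx _ _ (lexx 0) (y0 _ (leqnn n)) (y1 n).
rewrite subr0.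
(* The length of the incomplete step, rescaled by [x], is in [0, 1]. *)
have -> : x * y n = x - n%:R.
  by rewrite /y mulrBr mulr1 mulrCA divff ?mulr1// gt_eqF.
rewrite big_ord_recr/= -/(y n).
set S := \sum_(_ < n) _ in H1 H2 *; set G := g (y n) in H2 *.
have G0 : g 0 <= G by apply: g_nd => //; exact: y0.
have G1 : G <= g 1 by apply: g_nd => //; exact: y0.
have [u0 u1] : 0 <= x - n%:R /\ x - n%:R <= 1.
  by move: xn; rewrite -natr1; split; lra.
set u := x - n%:R in u0 u1 *.
have -> : x * (F 1 - F 0) = x * (F 1 - F (y n)) + x * (F (y n) - F 0) by ring.
set V := x * (F (y n) - F 0); set W := x * (F 1 - F (y n)) in H1 H2 *.
move=> h1 h2; rewrite ler_norml.
have a0 := ler_norm (g 0); have a0' := ler_norm (- g 0); rewrite normrN in a0'.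
have a1 := ler_norm (g 1); have a1' := ler_norm (- g 1); rewrite normrN in a1'.
have n0 := normr_ge0 (g 0); have n1 := normr_ge0 (g 1).
have scale_ge (c z K : R) : 0 <= c -> c <= 1 -> - K <= z -> 0 <= K -> - K <= c * z.
  by move=> c0 c1 zK K0; nra.
have b0 : - `|g 0| <= u * g 0 by apply: scale_ge => //; lra.
have b1 : - (`|g 0| + `|g 1|) <= (1 - u) * G by apply: scale_ge; lra.
by apply/andP; split; lra.
Qed.

(** The bound is independent of [x] and [n], which is what makes the error
    negligible after division by [x]. *)
Lemma riemann_sum_monotone (g : R -> R) (x : R) (n : nat) :
  (nondecreasing_fun g \/ nonincreasing_fun g) ->
  0 < x -> n%:R < x -> x <= n.+1%:R ->
  `|\sum_(k < n.+1) g (1 - k%:R / x) - x * \int[mu]_(y in `[0, 1]) g y|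
    <= `|g 0| + `|g 1|.
Proof.
move=> g_mono x0 nx xn.
have mg : measurable_fun setT g.
  by case: g_mono => ?; [exact: nondecreasing_measurable|exact: nonincreasing_measurable].
pose F t := \int[mu]_(y in `[0, t]) g y.
have F0 : F 0 = 0 by rewrite /F set_itv1 Rintegral_set1.
have -> : \int[mu]_(y in `[0, 1]) g y = F 1 - F 0 by rewrite F0 subr0.
have gM y : 0 <= y <= 1 -> `|g y| <= `|g 0| + `|g 1|.
  move=> /andP[y0 y1].
  have a0 := ler_norm (g 0); have a0' := ler_norm (- g 0); rewrite normrN in a0'.
  have a1 := ler_norm (g 1); have a1' := ler_norm (- g 1); rewrite normrN in a1'.
  have n0 := normr_ge0 (g 0); have n1 := normr_ge0 (g 1).
  by rewrite ler_norml; case: g_mono => h; have := h _ _ y0; have := h _ _ y1;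
    move=> h1 h2; apply/andP; split; lra.
case: g_mono => g_mono.
- apply: monotone_sum_increments => // [s t _ ts _|s t t0 ts s1].
    exact: g_mono.
  apply: (Rintegral_increment_bounds mg gM) => // y /andP[ty ys].
  by rewrite !g_mono.
- have -> : \sum_(k < n.+1) g (1 - k%:R / x) - x * (F 1 - F 0) =
      - (\sum_(k < n.+1) - g (1 - k%:R / x) - x * (- F 1 - - F 0)).
    by rewrite sumrN; ring.
  rewrite normrN -(normrN (g 0)) -(normrN (g 1)).
  apply: (@monotone_sum_increments (fun y => - g y) (fun y => - F y)) => //.
    by move=> s t _ ts _; rewrite lerN2 g_mono.
  move=> s t t0 ts s1; rewrite -opprD !mulrN !lerN2.
  have /andP[] := @Rintegral_increment_bounds g (g s) (g t) s t _ mg gM t0 ts s1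
    (fun y (h : t <= y <= s) => introT andP
      (conj (g_mono _ _ (proj2 (andP h))) (g_mono _ _ (proj1 (andP h))))).
  by rewrite -/(F s) -/(F t) => -> ->.
Qed.

End riemann_sums.

(** * The limiting cumulant function and its conjugate *)

Section monotone_integral.
Context (R : realType).
Local Notation mu := (@lebesgue_measure R).
Local Open Scope ereal_scope.

Lemma emeasurable_nondecreasing (f : R -> \bar R) :
  {homo f : s t / (s <= t)%R >-> (s <= t)%E} -> measurable_fun setT f.
Proof.
move=> f_nd; apply: (measurability _ (ErealGenCInfty.measurableE R)).
move=> _ [_ [r ->] <-]; rewrite setTI; apply: is_interval_measurable => s t/=.
rewrite !in_itv/= !andbT => fs ft u /andP[su ut].
by rewrite in_itv/= andbT (le_trans fs)// f_nd.
Qed.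

(** Positive and negative parts are monotone in opposite directions, and the
    difference of extended reals is monotone even at infinite values, so the
    comparison also covers integrals equal to [+oo]. *)
Lemma le_integral_measurable d (T : measurableType d)
    (m : {measure set T -> \bar R}) (D : set T) (f g : T -> \bar R) :
  measurable D -> measurable_fun D f -> measurable_fun D g ->
  (forall x, D x -> f x <= g x) ->
  \int[m]_(x in D) f x <= \int[m]_(x in D) g x.
Proof.
move=> mD mf mg fg; rewrite integralE [leRHS]integralE; apply: leeB.
- apply: ge0_le_integral => //.
  + exact: measurable_funepos.
  + exact: measurable_funepos.
  + by move=> x Dx; rewrite !funeposE ge_max !le_max fg//= lexx orbT.
- apply: ge0_le_integral => //.
  + exact: measurable_funeneg.
  + exact: measurable_funeneg.
  + by move=> x Dx; rewrite !funenegE ge_max !le_max leeN2 fg//= lexx orbT.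
Qed.

End monotone_integral.

Section limit_cumulant.
Context (R : realType) (f : R -> \bar R).
Hypothesis f_nd : {homo f : s t / (s <= t)%R >-> (s <= t)%E}.
Hypothesis f_gtNy : forall s, (-oo < f s)%E.
Local Notation mu := (@lebesgue_measure R).

(** As [f] is nondecreasing, its domain is a left half-line, and this is the
    interior of it. *)
Definition below_domain (s : R) : Prop :=
  exists2 t, s < t & (f t < +oo)%E.

(** The two conditions say that the whole segment joining [a.1] to
    [a.1 + a.2], over which [f] is averaged, is interior to the domain. *)
Definition core (a : R * R) : Prop :=
  below_domain a.1 /\ below_domain (a.1 + a.2).

Lemma below_domain_le s t : s <= t -> below_domain t -> below_domain s.
Proof. by move=> st [u tu fu]; exists u => //; exact: le_lt_trans tu. Qed.

Lemma below_domain_fin s : below_domain s -> f s \is a fin_num.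
Proof.
move=> [t st ft]; rewrite fin_numE -ltNye f_gtNy/= -ltey.
by apply: le_lt_trans ft; apply: f_nd; exact: ltW.
Qed.

Lemma below_domainD s : below_domain s -> exists2 e, 0 < e & below_domain (s + e).
Proof.
move=> [t st ft]; exists ((t - s) / 2); first by rewrite divr_gt0// subr_gt0.
by exists t => //; lra.
Qed.

Lemma below_domain_segment a y : core a -> 0 <= y -> y <= 1 ->
  below_domain (a.1 + a.2 * y).
Proof.
move=> [a1 a12] y0 y1; have [a2|a2] := leP 0 a.2.
- by apply: below_domain_le a12; rewrite lerD2l ler_piMr.
- apply: below_domain_le a1; rewrite gerDl.
  by rewrite mulr_le0_ge0// ltW.
Qed.

Lemma domain_has_ubound : effective_domain f <> setT ->
  has_ubound (effective_domain f).
Proof.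
move=> DT; have [s Ds] : exists s, ~ effective_domain f s.
  apply: contrapT => /forallNP h; apply: DT; apply/seteqP; split=> // s _.
  exact: contrapT (h s).
exists s => t Dt; rewrite leNgt; apply/negP => st; apply: Ds.
by apply: le_lt_trans Dt; apply: f_nd; exact: ltW.
Qed.

Lemma below_domain_in s : below_domain s -> effective_domain f s.
Proof. by move/below_domain_fin; rewrite /effective_domain/= ltey_eq => ->. Qed.

Lemma Lambda_core a : core a ->
  Lambda f a = (\int[mu]_(y in `[0%R, 1%R]) f (a.1 + a.2 * y)%R)%E.
Proof.
move=> [a1 a12]; rewrite /Lambda; case: asboolP => // DT.
rewrite asboolT//; have [a2|a2] := leP 0 a.2.
- by left; split=> //; exact: below_domain_in.
- right; split=> //; apply: ub_le_sup; last exact: below_domain_in.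
  exact: domain_has_ubound.
Qed.

(** Truncating [f] at the right end of the segment gives a finite monotone
    function that agrees with [f] on the segment, to which
    [riemann_sum_monotone] applies. *)
Lemma core_Lambda a : core a -> exists2 C : R,
  Lambda f a \is a fin_num &
  forall (x : R) (n : nat), 0 < x -> n%:R < x -> x <= n.+1%:R ->
  `|\sum_(k < n.+1) fine (f (a.1 + a.2 * (1 - k%:R / x)))
      - x * fine (Lambda f a)| <= C.
Proof.
move=> ca; have [a1 a12] := ca.
pose u := Num.max a.1 (a.1 + a.2).
have Du : below_domain u.
  by rewrite /u; case: (leP a.1 (a.1 + a.2)).
pose h s := fine (f (Num.min s u)).
have h_nd : nondecreasing_fun h.
  move=> s t st; apply: fine_le.
  - by apply: below_domain_fin; apply: below_domain_le Du; rewrite ge_min lexx orbT.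
  - by apply: below_domain_fin; apply: below_domain_le Du; rewrite ge_min lexx orbT.
  - apply: f_nd; rewrite le_min !ge_min st lexx orbT//.
pose g y := h (a.1 + a.2 * y).
have g_mono : nondecreasing_fun g \/ nonincreasing_fun g.
  have [a2|a2] := leP 0 a.2; [left|right] => s t st; apply: h_nd.
  - by rewrite lerD2l ler_wpM2l.
  - by rewrite lerD2l ler_wnM2l// ltW.
have gE y : 0 <= y -> y <= 1 -> f (a.1 + a.2 * y) = (g y)%:E.
  move=> y0 y1; rewrite /g /h min_l.
    by rewrite fineK//; exact/below_domain_fin/below_domain_segment.
  rewrite /u le_max; have [a2|a2] := leP 0 a.2.
  - by rewrite orbC lerD2l ler_piMr.
  - by rewrite gerDl mulr_le0_ge0// ltW.
have mg : measurable_fun setT g.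
  by case: g_mono => ?; [exact: nondecreasing_measurable|exact: nonincreasing_measurable].
have LE : Lambda f a = (\int[mu]_(y in `[0%R, 1%R]) (g y)%:E)%E.
  rewrite Lambda_core//; apply: eq_integral => y.
  by rewrite inE/= in_itv/= => /andP[y0 y1]; exact: gE.
have gfin : (\int[mu]_(y in `[0%R, 1%R]) (g y)%:E)%E \is a fin_num.
  apply: integrable_fin_num => //; apply: measurable_bounded_integrable => //.
  - by rewrite /= lebesgue_measure_itv/=; case: ifP => _; rewrite -?EFinB ?ltry.
  - exact: measurable_funS mg.
  - exists (`|g 0| + `|g 1|); split; first exact: num_real.
    move=> N MN y /=; rewrite in_itv/= => /andP[y0 y1].
    apply: le_trans (ltW MN).
    have a0 := ler_norm (g 0); have a0' := ler_norm (- g 0); rewrite normrN in a0'.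
    have b0 := ler_norm (g 1); have b0' := ler_norm (- g 1); rewrite normrN in b0'.
    have n0 := normr_ge0 (g 0); have n1 := normr_ge0 (g 1).
    by rewrite ler_norml; case: g_mono => hh; have := hh _ _ y0; have := hh _ _ y1;
      move=> h1 h2; apply/andP; split; lra.
exists (`|g 0| + `|g 1|); first by rewrite LE.
move=> x n x0 nx xn; rewrite LE.
rewrite (eq_bigr (fun k : 'I_n.+1 => g (1 - k%:R / x))).
  exact: riemann_sum_monotone.
move=> k _; rewrite gE//.
- rewrite subr_ge0 ler_pdivrMr// mul1r (le_trans _ (ltW nx))// ler_nat.
  by rewrite -ltnS.
- by rewrite lerBlDr lerDl divr_ge0// ltW.
Qed.

Lemma core_fin a : core a -> Lambda f a \is a fin_num.
Proof. by move=> /core_Lambda[]. Qed.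

(** Room to the right in the first coordinate, for the half-plane that
    controls large hitting times. *)
Lemma core_shift a : core a -> exists2 e, 0 < e & core (a.1 + e, a.2).
Proof.
move=> [/below_domainD[e1 e10 h1] /below_domainD[e2 e20 h2]].
exists (Num.min e1 e2); first by rewrite lt_min e10.
split=> /=.
- by apply: below_domain_le h1; rewrite lerD2l ge_min lexx.
- by apply: below_domain_le h2; rewrite addrAC lerD2l ge_min lexx orbT.
Qed.

Hypothesis f0 : below_domain 0.

(** Monotonicity of [f] alone brings a point of the domain into the core
    without increasing [Lambda], so suprema over the domain reduce to the
    core. *)
Lemma Lambda_left a e : 0 < e -> (Lambda f a < +oo)%E ->
  core (a.1 - e, a.2) /\ (Lambda f (a.1 - e, a.2)%R <= Lambda f a)%E.
Proof.
move=> e0 La.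
have [ca LE] : core (a.1 - e, a.2) /\
    Lambda f a = (\int[mu]_(y in `[0%R, 1%R]) f (a.1 + a.2 * y)%R)%E.
  move: La; rewrite /Lambda; case: asboolP => DT.
    move=> _; split=> //; have D s : below_domain s.
      exists (s + 1); first by rewrite ltrDl.
      by have : effective_domain f (s + 1) by rewrite DT.
    by split; exact: D.
  case: asboolP => // Da _; split => //.
  case: Da => -[/= a2 Da]; split => /=.
  - by exists (a.1 + a.2) => //; lra.
  - by exists (a.1 + a.2) => //; lra.
  - have [t Dt st] : exists2 t, effective_domain f t & a.1 - e < t.
      apply: sup_gt; last lra.
      by exists 0; exact: below_domain_in.
    by exists t => //; lra.
  - have [t Dt st] : exists2 t, effective_domain f t & a.1 - e < t.
      apply: sup_gt; last lra.
      by exists 0; exact: below_domain_in.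
    by exists t => //; lra.
split=> //; rewrite Lambda_core// LE.
have mfa (b : R) : measurable_fun setT (fun y : R => f (b + a.2 * y)).
  apply: (measurableT_comp (f := f)).
    exact: emeasurable_nondecreasing.
  by apply: measurable_funD => //; exact: measurable_funM.
apply: le_integral_measurable => //=.
- by apply: measurable_funTS; exact: mfa.
- by apply: measurable_funTS; exact: mfa.
by move=> y _; apply: f_nd; lra.
Qed.

Lemma Lambda_fin a : (Lambda f a < +oo)%E -> Lambda f a \is a fin_num.
Proof.
move=> La; have [/core_fin ca LE] := Lambda_left ltr01 La.
rewrite fin_numE -ltNye -[X in _ && X]ltey La andbT; apply: lt_le_trans LE.
by rewrite ltNye; move: ca; rewrite fin_numE => /andP[].
Qed.

Lemma Lambda_dom_le a s : (Lambda f a < +oo)%E -> ~ below_domain s ->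
  a.1 <= s /\ a.1 + a.2 <= s.
Proof.
move=> La Ds; split; rewrite leNgt; apply/negP => sa; apply: Ds.
- have := @Lambda_left a (a.1 - s); rewrite subr_gt0 => /(_ sa La)[[/=]].
  by rewrite opprB addrC subrK.
- have := @Lambda_left a (a.1 + a.2 - s); rewrite subr_gt0 => /(_ sa La)[[_ /=]].
  by rewrite (_ : _ - _ + _ = s)//; ring.
Qed.

Lemma conjugate_ge a z : (((dotp a z)%:E - Lambda f a) <= conjugate (Lambda f) z)%E.
Proof. by apply: ereal_sup_ubound; exists a. Qed.

Lemma conjugate_gt_core (l : R) z : (l%:E < conjugate (Lambda f) z)%E ->
  exists2 b, core b & l < dotp b z - fine (Lambda f b).
Proof.
move=> /ereal_sup_gt[_ [a _ <-]] la.
have La : (Lambda f a < +oo)%E.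
  by rewrite ltNge leye_eq; apply/eqP => E; move: la; rewrite E.
have Lfin : Lambda f a \is a fin_num by exact: Lambda_fin.
move: la; rewrite -(fineK Lfin) -EFinB lte_fin => la.
set r := fine (Lambda f a) in la.
pose e := (dotp a z - r - l) / (2 * (`|z.1| + 1)).
have z1 := normr_ge0 z.1.
have e0 : 0 < e by rewrite divr_gt0//; lra.
have [cb Lb] := Lambda_left e0 La.
exists (a.1 - e, a.2) => //.
have {}Lb : fine (Lambda f (a.1 - e, a.2)) <= r by apply: fine_le => //; exact: core_fin.
have ez : e * z.1 <= e * `|z.1| by apply: ler_wpM2l; [exact: ltW|exact: ler_norm].
have ee : e * (2 * (`|z.1| + 1)) = dotp a z - r - l.
  by rewrite /e mulfVK// gt_eqF//; lra.
have -> : dotp (a.1 - e, a.2) z = dotp a z - e * z.1 by rewrite /dotp/=; ring.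
lra.
Qed.

Lemma core0 : core 0.
Proof. by split; rewrite /= ?addr0. Qed.

Lemma conjugate_gtNy w : (-oo < conjugate (Lambda f) w)%E.
Proof.
apply: lt_le_trans (conjugate_ge 0 w).
by rewrite -(fineK (core_fin core0)) -EFinB ltNyr.
Qed.

(** If [v] is an outer normal to the domain at [a], every [b] in the domain
    gives [<b, w + v> <= <b, w> + <a, v>], whence
    [Lambda^* (w + v) <= Lambda^* w + <a, v>]: the point [w + v] does as well
    as [w] for [a]. *)
Lemma supporting_direction_not_exposing a w v :
  (forall b, (Lambda f b < +oo)%E -> dotp b v <= dotp a v) -> v <> 0 ->
  ~ (forall z, z <> w -> ((dotp a z)%:E - conjugate (Lambda f) z <
     (dotp a w)%:E - conjugate (Lambda f) w)%E).
Proof.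
move=> bv v0 /(_ (w + v)) aw.
have wv : w + v <> w by move=> /eqP; rewrite -subr_eq0 addrAC subrr add0r => /eqP.
move: aw => /(_ wv).
have J0 := conjugate_gtNy w.
have [Jy|Jy] := eqVneq (conjugate (Lambda f) w) +oo%E.
  by rewrite Jy/= addeNy ltNge leNye.
have Jfin : conjugate (Lambda f) w \is a fin_num by rewrite fin_numE gt_eqF.
rewrite -(fineK Jfin); set j := fine _.
have Jv : (conjugate (Lambda f) (w + v)%R <= (j + dotp a v)%:E)%E.
  apply: ge_ereal_sup => _ [b _ <-].
  have [Lb|] := ltP (Lambda f b) +oo%E; last first.
    by rewrite leye_eq => /eqP ->; rewrite addeNy leNye.
  have := conjugate_ge b w; rewrite -(fineK Jfin) -(fineK (Lambda_fin Lb)) -!EFinB.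
  rewrite !lee_fin -/j => h; have := bv _ Lb.
  have -> : dotp b (w + v) = dotp b w + dotp b v by rewrite /dotp/=; ring.
  lra.
apply/negP; rewrite -leNgt.
have -> : dotp a (w + v) = dotp a w + dotp a v by rewrite /dotp/=; ring.
apply: le_trans (leeB (lexx _) Jv).
by rewrite -!EFinB lee_fin; lra.
Qed.

(** Outside the core one of [a.1], [a.1 + a.2] is not interior to the domain
    of [f], and bounds the corresponding coordinate over the domain of
    [Lambda]. *)
Lemma exposing_core a w :
  (forall z, z <> w -> ((dotp a z)%:E - conjugate (Lambda f) z <
     (dotp a w)%:E - conjugate (Lambda f) w)%E) -> core a.
Proof.
move=> aw; apply: contrapT => /not_andP[Da|Da]; move: aw.
- apply: (@supporting_direction_not_exposing _ _ (1, 0)).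
    by move=> b /Lambda_dom_le/(_ Da)[+ _]; rewrite /dotp/=; lra.
  by move=> [/eqP]; rewrite oner_eq0.
- apply: (@supporting_direction_not_exposing _ _ (1, 1)).
    by move=> b /Lambda_dom_le/(_ Da)[_ +]; rewrite /dotp/=; lra.
  by move=> [/eqP]; rewrite oner_eq0.
Qed.

(** Exposing is a comparison with the value at [w]; by Young's inequality at
    [w], the affine function tangent at [a] lies strictly below [Lambda^*]
    away from [w]. *)
Lemma conjugate_gt_tangent a w z :
  ((dotp a z)%:E - conjugate (Lambda f) z <
     (dotp a w)%:E - conjugate (Lambda f) w)%E -> core a ->
  ((dotp a z - fine (Lambda f a))%:E < conjugate (Lambda f) z)%E.
Proof.
move=> zw ca; have := conjugate_ge a w; have J0 := conjugate_gtNy z.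
have Jw0 := conjugate_gtNy w.
rewrite -(fineK (core_fin ca)) -EFinB; move: zw J0 Jw0.
case: (conjugate _ z) => [jz| |]; case: (conjugate _ w) => [jw| |]//=;
  rewrite ?ltry// -?EFinB ?lte_fin ?lee_fin; lra.
Qed.

End limit_cumulant.

(** * Covering closed sets by finitely many half-planes *)

Section half_plane_cover.
Context (R : realType) (U : set (R * R)) (L : R * R -> R) (a : R * R) (l : R).

Definition gain (b z : R * R) : R := (dotp b z - L b) - (dotp a z - L a).

(** A finite cover with a uniform margin [e], which is what survives in the
    exponential rate. *)
Definition half_plane_covered (H : set (R * R)) : Prop :=
  exists (bs : seq (R * R)) (e : R), [/\ 0 < e, (forall b, b \in bs -> U b) &
    forall z, H z -> exists2 b, b \in bs & l + e <= gain b z].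

Lemma half_plane_coveredW (A B : set (R * R)) : A `<=` B ->
  half_plane_covered B -> half_plane_covered A.
Proof.
by move=> AB [bs [e [e0 Ubs cov]]]; exists bs, e; split=> // z /AB/cov.
Qed.

Lemma half_plane_coveredU (A B : set (R * R)) :
  half_plane_covered A -> half_plane_covered B -> half_plane_covered (A `|` B).
Proof.
move=> [bs [e [e0 Ubs covA]]] [cs [e' [e'0 Ucs covB]]].
exists (bs ++ cs), (Num.min e e'); split; first by rewrite lt_min e0.
- by move=> b; rewrite mem_cat => /orP[/Ubs|/Ucs].
- move=> z [/covA|/covB] [b bin lb]; exists b; rewrite ?mem_cat ?bin ?orbT//.
  + by apply: le_trans lb; rewrite lerD2l ge_min lexx.
  + by apply: le_trans lb; rewrite lerD2l ge_min lexx orbT.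
Qed.

(** Sets of which the complement in [K] is covered form a filter, because
    finite unions of covered sets are covered. If [K] were not covered, this
    filter would be proper and have a cluster point in [K], near which the
    local cover gives a contradiction. *)
Lemma half_plane_covered_compact (K : set (R * R)) : compact K ->
  (forall z, K z -> exists2 V, nbhs z V & half_plane_covered V) ->
  half_plane_covered K.
Proof.
move=> cK Kloc; apply: contrapT => nK.
pose F : set_system (R * R) := [set A | half_plane_covered (K `\` A)].
have covK0 : half_plane_covered set0 by exists [::], 1; split.
have FF : Filter F.
  split.
  - by rewrite /F/= setDT.
  - move=> A B; rewrite /F/= setDIr; exact: half_plane_coveredU.
  - by move=> A B AB; apply: half_plane_coveredW; exact: setDS.
have PF : ProperFilter F.
  by split=> // F0; apply: nK; move: F0; rewrite /F/= setD0.
have FK : F K by rewrite /F/= setDv.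
have [z [Kz clz]] := cK F PF FK.
have [V Vz covV] := Kloc z Kz.
have FV : F (~` V).
  by rewrite /F/= setDE setCK; apply: half_plane_coveredW covV; exact: subIsetr.
by have [y [nVy Vy]] := clz _ _ FV Vz.
Qed.

Lemma continuous_gain b : continuous (gain b : R * R -> R).
Proof.
move=> z; rewrite /gain /dotp.
have lin (c : R * R) (k : R) : (c.1 * y.1 + c.2 * y.2 - k) @[y --> z] -->
    c.1 * z.1 + c.2 * z.2 - k.
  apply: cvgB; last exact: cvg_cst.
  by apply: cvgD; (apply: cvgM; first exact: cvg_cst); [exact: cvg_fst|exact: cvg_snd].
by apply: cvgB; exact: lin.
Qed.

(** In the cone [0 <= z.2 <= z.1], bounding the first coordinate leaves a
    compact set, and a large first coordinate is detected by the single
    vector [a + (e, 0)]. *)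
Lemma half_plane_cover (C : set (R * R)) :
  closed C -> (exists2 e, 0 < e & U (a.1 + e, a.2)) ->
  (forall z, C z -> exists2 b, U b & l < gain b z) ->
  half_plane_covered (C `&` [set z | 0 <= z.2 <= z.1]).
Proof.
move=> cC [e e0 Ue] Cb.
pose b0 : R * R := (a.1 + e, a.2).
(* Beyond abscissa [M] the gain of [b0] is at least [l + 1]. *)
pose M := (l + 1 + L b0 - L a) / e.
have gain0 z : gain b0 z = e * z.1 - L b0 + L a by rewrite /gain /dotp/=; ring.
pose K := (`[0, M] `*` `[0, M])%classic `&` C : set (R * R).
have cK : compact K.
  apply: compact_closedI => //.
  by apply: compact_setX; exact: segment_compact.
have KV : half_plane_covered K.
  apply: half_plane_covered_compact => // z [_ /Cb[b Ub lb]].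
  exists [set y | l + (gain b z - l) / 2 < gain b y].
    by apply: (cvgr_gt _ (@continuous_gain b z)); lra.
  exists [:: b], ((gain b z - l) / 2); split.
  - by rewrite divr_gt0// subr_gt0.
  - by move=> c; rewrite inE => /eqP ->.
  - by move=> y /ltW yb; exists b; rewrite ?mem_head.
apply: (@half_plane_coveredW _ (K `|` [set z | M <= z.1])).
  move=> z [Cz /= /andP[z2 z12]].
  have [Mz|zM] := leP M z.1; [by right|left]; split=> //; split => /=;
    rewrite in_itv/=; apply/andP; split=> //.
  - exact: le_trans z12.
  - exact: ltW.
  - exact: le_trans (ltW zM).
apply: half_plane_coveredU => //.
exists [:: b0], 1; split=> //.
- by move=> c; rewrite inE => /eqP ->.
- move=> z /= Mz; exists b0; first exact: mem_head.
  have : e * M <= e * z.1 by rewrite ler_wpM2l// ltW.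
  by rewrite gain0 /M mulrCA divff ?gt_eqF// mulr1; lra.
Qed.

End half_plane_cover.

(** * Exponential moments of the scaled pair *)

Section cumulant.
Context d (Omega : measurableType d) (R : realType) (P : probability Omega R).
Local Open Scope ereal_scope.

Lemma integral_expR_gt0 (X : Omega -> R) : measurable_fun setT X ->
  0 < \int[P]_w (expR (X w))%:E.
Proof.
move=> mX.
have mE : measurable_fun setT (EFin \o (expR \o X)).
  by apply/measurable_EFinP; exact: measurableT_comp.
rewrite lt_neqAle integral_ge0 ?andbT; last by move=> w _; rewrite lee_fin expR_ge0.
apply/eqP => /esym I0.
have : ae_eq P setT (EFin \o (expR \o X)) (cst 0).
  apply/(ae_eq_integral_abs P measurableT mE); rewrite -[RHS]I0.
  by apply: eq_integral => w _ /=; rewrite ger0_norm// expR_ge0.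
move=> [N [mN N0 sub]]; have : N = setT.
  apply/seteqP; split=> // w _; apply: sub => /= h.
  have := h Logic.I => /= -[] /eqP; apply/negP.
  by rewrite gt_eqF// expR_gt0.
move=> NT; have PN : P N = 1 by rewrite NT probability_setT.
by have := etrans (esym N0) PN => /eqP; rewrite eq_sym onee_eq0.
Qed.

Lemma mgfE (X : Omega -> R) s : 'M_P X s = \int[P]_w (expR (s * X w))%:E.
Proof.
rewrite /mmt_gen_fun unlock; apply: eq_integral => w _ /=.
by rewrite mulrC.
Qed.

Lemma phi_gtNy (X : {RV P >-> R}) s : -oo < phi P X s.
Proof.
rewrite /phi mgfE; have : 0 < \int[P]_w (expR (s * X w))%:E.
  by apply: integral_expR_gt0; exact: measurable_funM.
case: (\int[P]_w _) => [r| |]//=; rewrite lte_fin => r0.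
by rewrite leNgt r0/= ltNyr.
Qed.

Lemma phi_nd (X : {RV P >-> R}) : (forall w, 0 < X w)%R ->
  {homo phi P X : s t / (s <= t)%R >-> s <= t}.
Proof.
move=> X0 s t st; rewrite /phi.
have mE u : measurable_fun setT (fun w => (expR (u * X w))%:E).
  by apply/measurable_EFinP; apply: measurableT_comp => //; exact: measurable_funM.
have M0 u : 'M_P X u \in `[0, +oo].
  rewrite in_itv/= leey andbT mgfE integral_ge0// => w _.
rewrite lee_lne// !mgfE; apply: ge0_le_integral => //.
by move=> w _; rewrite lee_fin ler_expR ler_wpM2r// ltW.
Qed.

Lemma phi0 (X : Omega -> R) : phi P X 0 = 0.
Proof.
rewrite /phi mgfE; under eq_integral do rewrite mul0r expR0.
have -> : \int[P]_(w in setT) (1%E : \bar R) = 1.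
  by rewrite (integral_cst _ _ 1)// mul1e; exact: probability_setT.
exact: lne1.
Qed.

Lemma mgf_fin (X : {RV P >-> R}) s : phi P X s \is a fin_num ->
  \int[P]_w (expR (s * X w))%:E = (expR (fine (phi P X s)))%:E.
Proof.
have I0 : 0 < \int[P]_w (expR (s * X w))%:E.
  by apply: integral_expR_gt0; exact: measurable_funM.
rewrite /phi mgfE; move: I0; case: (\int[P]_w _) => [r| |]//=.
by rewrite lte_fin => r0 _; rewrite leNgt r0/= lnK.
Qed.

Lemma integral_ident (T : nat -> {RV P >-> R}) (g : R -> R) k :
  identically_distributed P T -> measurable_fun setT g -> (forall y, 0 <= g y)%R ->
  \int[P]_w (g (T k w))%:E = \int[P]_w (g (T 0%N w))%:E.
Proof.
move=> Tid mg g0.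
have pf j : \int[P]_w (g (T j w))%:E = \int[pushforward P (T j)]_y (g y)%:E.
  rewrite ge0_integral_pushforward ?preimage_setT//.
  - exact/measurable_EFinP.
  - by move=> y _; rewrite lee_fin.
rewrite !pf; apply: eq_measure_integral => A mA _.
exact: Tid.
Qed.

End cumulant.

Section scaled_pair_mgf.
Context d (Omega : measurableType d) (R : realType) (P : probability Omega R).
Context (T : nat -> {RV P >-> R}).
Hypothesis T_gt0 : forall n w, 0 < T n w.

Lemma nat_between (x : R) : 0 < x -> exists2 n : nat, n%:R < x & x <= n.+1%:R.
Proof.
move=> x0; have ex : exists m : nat, x <= m%:R.
  by exists (Num.bound x); apply/ltW/archi_boundP/ltW.
case: (ex_minnP ex) => -[|n] xm min_m; first by rewrite leNgt x0 in xm.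
exists n => //; rewrite ltNge; apply/negP => /min_m; by rewrite ltnn.
Qed.

Lemma scaled_pairE x n w : n%:R < x -> x <= n.+1%:R ->
  scaled_pair T x w = (partial_sum T n.+1 w / x,
    (\sum_(k < n.+1) (x - k%:R) * T k w) / x ^+ 2).
Proof.
by move=> nx xn; rewrite /scaled_pair (hitting_time_eq _ nx xn)// (swept_area_eq _ nx xn).
Qed.

(** The area lies in the rectangle of sides [tau(x)] and [x]; this confines
    the pair to a cone, and only one coordinate has to be controlled at
    infinity. *)
Lemma scaled_pair_cone x w : 0 < x ->
  0 <= (scaled_pair T x w).2 <= (scaled_pair T x w).1.
Proof.
move=> x0; have [n nx xn] := nat_between x0.
have kx (k : 'I_n.+1) : k%:R <= x.
  by rewrite (le_trans _ (ltW nx))// ler_nat -ltnS.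
rewrite (scaled_pairE _ nx xn)/=; apply/andP; split.
- apply: divr_ge0; last by rewrite exprn_ge0// ltW.
  by apply: sumr_ge0 => k _; rewrite mulr_ge0 ?subr_ge0 ?kx// ltW.
- rewrite ler_pdivrMr ?exprn_gt0// expr2 mulrA divfK ?gt_eqF// mulr_suml.
  apply: ler_sum => k _; rewrite mulrC; apply: ler_wpM2l; first exact: ltW.
  by rewrite gerBl.
Qed.

Lemma measurable_scaled_pair x : 0 < x ->
  measurable_fun setT (fun w => (scaled_pair T x w).1) /\
  measurable_fun setT (fun w => (scaled_pair T x w).2).
Proof.
move=> x0; have [n nx xn] := nat_between x0; split.
- rewrite (_ : (fun _ => _) = fun w => (\sum_(k < n.+1) T k w) * x^-1).
    by apply: measurable_funM => //; apply: measurable_sum.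
  by apply/funext => w; rewrite (scaled_pairE _ nx xn).
- rewrite (_ : (fun _ => _) =
      fun w => (\sum_(k < n.+1) (x - k%:R) * T k w) * (x ^+ 2)^-1).
    apply: measurable_funM => //; apply: measurable_sum => k.
    exact: measurable_funM.
  by apply/funext => w; rewrite (scaled_pairE _ nx xn).
Qed.

Hypothesis T_indep : mutually_independent P T.
Hypothesis T_ident : identically_distributed P T.
Local Notation f := (phi P (T 0%N)).

Lemma dotp_scaled_pair (b : R * R) x n w : n%:R < x -> x <= n.+1%:R ->
  x * dotp b (scaled_pair T x w) =
    \sum_(k < n.+1) (b.1 + b.2 * (1 - k%:R / x)) * T k w.
Proof.
move=> nx xn; have x0 : x != 0.
  by rewrite gt_eqF// (le_lt_trans _ nx).
rewrite (scaled_pairE _ nx xn) /dotp/=.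
have -> : x * (b.1 * (partial_sum T n.+1 w / x) +
    b.2 * ((\sum_(k < n.+1) (x - k%:R) * T k w) / x ^+ 2)) =
  b.1 * partial_sum T n.+1 w + b.2 / x * (\sum_(k < n.+1) (x - k%:R) * T k w).
  by field.
rewrite /partial_sum !mulr_sumr -big_split/=; apply: eq_bigr => k _.
by field.
Qed.

(** By independence the exponential moment is the exponential of a Riemann
    sum of the cumulant function along the segment from [b.1 + b.2] to
    [b.1]. *)
Lemma mgf_scaled_pair (b : R * R) : core f b -> exists C : R, forall x, 0 < x ->
  exists2 r, `|r - x * fine (Lambda f b)| <= C &
    (\int[P]_w (expR (x * dotp b (scaled_pair T x w)))%:E = (expR r)%:E)%E.
Proof.
move=> cb; have f_nd := phi_nd (T_gt0 0).
have [C _ HC] := core_Lambda f_nd (@phi_gtNy _ _ _ P (T 0%N)) cb.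
exists C => x x0; have [n nx xn] := nat_between x0.
exists (\sum_(k < n.+1) fine (f (b.1 + b.2 * (1 - k%:R / x)))); first exact: HC.
pose s (k : nat) := b.1 + b.2 * (1 - k%:R / x).
under eq_integral do rewrite (dotp_scaled_pair _ _ nx xn) expR_sum.
have mg i : measurable_fun setT (fun y : R => expR (s i * y)).
  by apply: measurableT_comp => //; exact: measurable_funM.
rewrite (@integral_prod_indep _ _ _ P T (fun k y => expR (s k * y))
  (fun k => expR (fine (f (s k)))))//.
- by rewrite expR_sum.
- move=> k kn; rewrite (@integral_ident _ _ _ P T (fun y => expR (s k * y)))//.
  apply: mgf_fin; apply: (below_domain_fin f_nd (@phi_gtNy _ _ _ P (T 0%N))).
  apply: below_domain_segment => //.
  + rewrite subr_ge0 ler_pdivrMr// mul1r (le_trans _ (ltW nx))// ler_nat.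
    by rewrite -ltnS.
  + by rewrite lerBlDr lerDl divr_ge0// ltW.
Qed.

End scaled_pair_mgf.

(** * Events and logarithmic scale *)

Section borel_plane.
Context d (Omega : measurableType d) (R : realType).

Lemma nbhs_prodR (z : R * R) (O : set (R * R)) : nbhs z O ->
  exists2 e, 0 < e &
    forall y, `|z.1 - y.1| < e -> `|z.2 - y.2| < e -> O y.
Proof.
by move=> /nbhs_ballP[e /= e0 eO]; exists e => // y y1 y2; apply: eO; split.
Qed.

(** An open set of the plane is the union of the rational boxes that it
    contains. *)
Lemma measurable_preimage_open (X Y : Omega -> R) (O : set (R * R)) :
  measurable_fun setT X -> measurable_fun setT Y -> open O ->
  measurable [set w | O (X w, Y w)].
Proof.
move=> mX mY oO.
pose box (i : (rat * rat) * (rat * rat)) : set (R * R) :=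
  [set z | ratr i.1.1 < z.1 < ratr i.1.2 /\ ratr i.2.1 < z.2 < ratr i.2.2].
pose F i : set Omega :=
  if `[< box i `<=` O >] then [set w | box i (X w, Y w)] else set0.
have -> : [set w | O (X w, Y w)] = \bigcup_i F i.
  apply/seteqP; split=> [w /= Ow|w [i _]]; last first.
    by rewrite /F; case: asboolP => // h; apply: h.
  have [e e0 eO] := nbhs_prodR (open_nbhs_nbhs (conj oO Ow)).
  have rat_near (y : R) : exists2 p : rat * rat,
      y - e < ratr p.1 < y & y < ratr p.2 < y + e.
    have [p1] := @rat_in_itvoo R (y - e) y ltac:(lra).
    have [p2] := @rat_in_itvoo R y (y + e) ltac:(lra).
    by rewrite !in_itv/= => h2 h1; exists (p1, p2).
  have [p /andP[p1 p2] /andP[p3 p4]] := rat_near (X w).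
  have [q /andP[q1 q2] /andP[q3 q4]] := rat_near (Y w).
  exists (p, q) => //; rewrite /F asboolT.
    by rewrite /box/= p2 p3 q2 q3.
  move=> z [/= /andP[z1 z2] /andP[z3 z4]].
  by apply: eO => /=; rewrite ltr_norml; apply/andP; split; lra.
apply: countable_bigcupT_measurable => //= i.
rewrite /F; case: asboolP => // _.
have mI (Z : Omega -> R) (p : rat * rat) : measurable_fun setT Z ->
    measurable [set w | ratr p.1 < Z w < ratr p.2].
  move=> mZ.
  rewrite (_ : mkset _ = setT `&` Z @^-1` `]ratr p.1, ratr p.2[); first exact: mZ.
  by apply/seteqP; split=> w /=; rewrite in_itv/=; [|case].
rewrite (_ : mkset _ = [set w | ratr i.1.1 < X w < ratr i.1.2] `&`
  [set w | ratr i.2.1 < Y w < ratr i.2.2])//.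
by apply: measurableI; exact: mI.
Qed.

End borel_plane.

Section log_scale.
Context (R : realType).
Local Open Scope ereal_scope.

Lemma lne_scale_le (x r : R) (p : \bar R) : (0 < x)%R -> 0 <= p ->
  p <= (expR r)%:E -> (x^-1)%:E * lne p <= (r / x)%:E.
Proof.
move=> x0 p0 pr; rewrite [(r / x)%R]mulrC EFinM lee_pmul2l ?lte_fin ?invr_gt0//.
have <- : lne (expR r)%:E = r%:E by rewrite lne_EFin ?expR_gt0// expRK.
by rewrite lee_lne// in_itv/= ?leey ?andbT// lee_fin expR_ge0.
Qed.

Lemma lne_scale_ge (x r : R) (p : \bar R) : (0 < x)%R ->
  (expR r)%:E <= p -> (r / x)%:E <= (x^-1)%:E * lne p.
Proof.
move=> x0 pr; rewrite [(r / x)%R]mulrC EFinM lee_pmul2l ?lte_fin ?invr_gt0//.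
have <- : lne (expR r)%:E = r%:E by rewrite lne_EFin ?expR_gt0// expRK.
have e0 : 0 <= (expR r)%:E by rewrite lee_fin expR_ge0.
by rewrite lee_lne// in_itv/= leey andbT// (le_trans e0).
Qed.

Lemma real_between (p q : \bar R) : p < q ->
  exists2 r : R, p < r%:E & r%:E < q.
Proof.
case: p q => [p| |] [q| |]//=.
- by rewrite lte_fin => pq; exists ((p + q) / 2)%R; rewrite lte_fin; lra.
- by move=> _; exists (p + 1)%R; rewrite ?ltry// lte_fin ltrDl.
- by move=> _; exists (q - 1)%R; rewrite ?ltNyr// lte_fin gtrBl.
- by exists 0%R; rewrite ?ltry ?ltNyr.
Qed.

Lemma limf_esup_le (u : R -> \bar R) (F : set_system R) (M : \bar R) :
  (\forall x \near F, u x <= M) -> limf_esup u F <= M.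
Proof.
move=> uM; apply: ereal_inf_le; exists (ereal_sup (u @` [set x | u x <= M])).
  by exists [set x | u x <= M].
by apply: ge_ereal_sup => _ [x xM <-].
Qed.

Lemma limf_einf_ge (u : R -> \bar R) (F : set_system R) (M : \bar R) :
  Filter F ->
  (\forall x \near F, M <= u x) -> M <= limf_einf u F.
Proof.
move=> FF Mu; rewrite /limf_einf leeNr; apply: limf_esup_le.
by apply: filterS Mu => x; rewrite leeN2.
Qed.

End log_scale.

Lemma dotp_near (R : realType) (a w z : R * R) (dl : R) :
  `|w.1 - z.1| < dl -> `|w.2 - z.2| < dl ->
  dotp a z <= dotp a w + (`|a.1| + `|a.2|) * dl.
Proof.
move=> h1 h2; have coord (c u v : R) : `|u - v| < dl -> c * v <= c * u + `|c| * dl.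
  move=> uv; have : `|c * (v - u)| <= `|c| * dl.
    by rewrite normrM distrC ler_wpM2l// ltW.
  by rewrite ler_norml => /andP[_]; rewrite mulrBr; lra.
have := coord a.1 _ _ h1; have := coord a.2 _ _ h2.
by rewrite /dotp mulrDl; lra.
Qed.

(** * Exponential bounds *)

Section large_deviations.
Context d (Omega : measurableType d) (R : realType) (P : probability Omega R).
Context (T : nat -> {RV P >-> R}).
Hypothesis T_gt0 : forall n w, 0 < T n w.
Hypothesis T_indep : mutually_independent P T.
Hypothesis T_ident : identically_distributed P T.
Local Notation f := (phi P (T 0%N)).
Hypothesis f0 : below_domain f 0.
Local Notation Lam b := (fine (Lambda f b)).
Local Notation Z x w := (scaled_pair T x w).

Let f_nd : {homo f : s t / s <= t >-> (s <= t)%E} := phi_nd (T_gt0 0).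
Let f_gtNy : forall s, (-oo < f s)%E := @phi_gtNy _ _ _ P (T 0%N).

Lemma measurable_event_open x (O : set (R * R)) : 0 < x -> open O ->
  measurable [set w | O (Z x w)].
Proof.
move=> x0 oO; have [m1 m2] := measurable_scaled_pair T_gt0 x0.
have := measurable_preimage_open m1 m2 oO.
by under eq_fun do rewrite -surjective_pairing.
Qed.

Lemma measurable_event_closed x (C : set (R * R)) : 0 < x -> closed C ->
  measurable [set w | C (Z x w)].
Proof.
move=> x0 cC; rewrite -[X in measurable X]setCK; apply: measurableC.
by apply: (@measurable_event_open x (~` C)) => //; exact: closed_openC.
Qed.

Lemma measurable_tilt x (b : R * R) : 0 < x ->
  measurable_fun setT (fun w => (expR (x * dotp b (Z x w)))%:E).
Proof.
move=> x0; have [m1 m2] := measurable_scaled_pair T_gt0 x0.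
apply/measurable_EFinP; apply: measurableT_comp => //.
apply: measurable_funM => //; rewrite /dotp.
by apply: measurable_funD; exact: measurable_funM.
Qed.

(** On the half-plane of [b], the weight [exp (x <a, Z>)] is at most
    [exp (x <b, Z>)] times a deterministic factor, and the expectation of the
    latter is known up to a constant factor. Summing over a finite cover
    bounds the integral. The case [a = 0] is Chernoff's bound; the general one
    says that the law tilted by [a] gives little mass to [C]. *)
Lemma tilted_closed_bound (a : R * R) (l : R) (C : set (R * R)) :
  core f a -> closed C ->
  (forall z, C z -> exists2 b, core f b & l < gain (fun b => Lam b) a b z) ->
  exists K e : R, 0 < e /\ forall x, 0 < x ->
    (\int[P]_(w in [set w | C (Z x w)]) (expR (x * dotp a (Z x w)))%:E <=
      (expR (K + x * (Lam a - (l + e))))%:E)%E.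
Proof.
move=> ca cC Cb.
have gain_bound (m A B u v : R) : m <= (B - v) - (A - u) -> A <= u - m - v + B.
  by lra.
have exponent_sum (x q u v : R) : x * (u - v) + (q + x * v) <= q + x * u by lra.
have [bs [e [e0 cbs cover]]] :=
  half_plane_cover cC (core_shift ca) Cb.
(* [choice] collects the constants of the vectors of the cover. *)
have /choice[k kP] : forall b, exists k : R, core f b -> forall x, 0 < x ->
    (\int[P]_w (expR (x * dotp b (Z x w)))%:E <= (expR (k + x * Lam b))%:E)%E.
  move=> b; have [cb|ncb] := pselect (core f b); last by exists 0.
  have [k kb] := mgf_scaled_pair T_gt0 T_indep T_ident cb.
  exists k => _ x x0; have [r rk ->] := kb x x0.
  rewrite lee_fin ler_expR; move: rk; rewrite ler_norml => /andP[_]; lra.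
pose s := \sum_(b <- bs) expR (k b).
have s0 : 0 <= s by apply: sumr_ge0 => b _; exact: expR_ge0.
(* [s] may vanish (empty cover); adding 1 keeps the logarithm meaningful. *)
exists (ln (s + 1)), e; split=> // x x0.
set A := [set w | C (Z x w)].
have mA : measurable A by exact: measurable_event_closed.
pose c b := expR (x * (Lam a - (l + e) - Lam b)).
have c0 b : 0 <= c b by exact: expR_ge0.
have mt b := measurable_tilt b x0.
apply: (@le_trans _ _ (\int[P]_w
    \sum_(b <- bs) ((c b)%:E * (expR (x * dotp b (Z x w)))%:E))%E).
  rewrite integral_mkcond; apply: ge0_le_integral => //.
  - by move=> w _; rewrite patchE; case: ifP => // _; rewrite lee_fin expR_ge0.
  - by apply/(measurable_restrictT _ mA).1; exact: measurable_funTS.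
  - apply: emeasurable_sum => b; exact: measurable_funeM.
  move=> w _; rewrite patchE; case: ifPn => [|_]; last first.
    by apply: sume_ge0 => b _; rewrite -EFinM lee_fin mulr_ge0 ?expR_ge0.
  rewrite inE => Aw.
  have [b bbs gb] := cover (Z x w) (conj Aw (scaled_pair_cone T_gt0 w x0)).
  rewrite (big_rem b bbs)/= -[leLHS]adde0; apply: leeD; last first.
    by apply: sume_ge0 => b' _; rewrite -EFinM lee_fin mulr_ge0 ?expR_ge0.
  rewrite -EFinM lee_fin /c -expRD ler_expR -mulrDr ler_pM2l//.
  move: gb; rewrite /gain.
  exact: gain_bound.
rewrite ge0_integral_sum//; last 2 first.
- by move=> b; exact: measurable_funeM.
- by move=> b w _; rewrite -EFinM lee_fin mulr_ge0 ?expR_ge0.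
apply: (@le_trans _ _ (\sum_(b <- bs) (expR (k b) * expR (x * (Lam a - (l + e))))%:E)%E).
  rewrite big_seq [leRHS]big_seq; apply: lee_sum => b bbs.
  rewrite ge0_integralZl_EFin//.
  apply: (@le_trans _ _ ((c b)%:E * (expR (k b + x * Lam b))%:E)%E).
    by rewrite lee_wpmul2l ?lee_fin ?c0//; exact/kP/x0/cbs.
  rewrite -EFinM lee_fin /c -!expRD ler_expR.
    exact: exponent_sum.
rewrite sumEFin -mulr_suml lee_fin expRD lnK ?posrE; last by lra.
by rewrite ler_wpM2r ?expR_ge0// lerDl.
Qed.

Lemma Lambda0 : Lam 0 = 0.
Proof.
rewrite (Lambda_core f_nd f_gtNy (core0 f0)).
have -> : (\int[@lebesgue_measure R]_(y in `[0%R, 1%R])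
    f ((0 : R * R)%R.1 + (0 : R * R)%R.2 * y) = 0)%E; last by [].
by apply: integral0_eq => y _; rewrite mul0r addr0 phi0.
Qed.

Lemma closed_upper_bound (C : set (R * R)) (l : R) : closed C ->
  (forall z, C z -> (l%:E < conjugate (Lambda f) z)%E) ->
  \forall x \near +oo,
    ((x^-1)%:E * lne (P [set w | C (Z x w)]) <= (- l)%:E)%E.
Proof.
move=> cC Cl.
have [] := @tilted_closed_bound 0 l C (core0 f0) cC.
  move=> z /Cl/(conjugate_gt_core f_nd f_gtNy f0)[b cb lb]; exists b => //.
  by rewrite /gain Lambda0 /dotp/= !mul0r addr0 subr0 subr0.
move=> K [e [e0 bound]]; near=> x.
have x0 : 0 < x by near: x; apply: nbhs_pinfty_gt; exact: num_real.
have mA := measurable_event_closed x0 cC.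
have PA : (P [set w | C (Z x w)] <= (expR (K + x * - (l + e)))%:E)%E.
  have := bound x x0; rewrite Lambda0 sub0r; apply: le_trans.
  under eq_integral do rewrite /dotp/= !mul0r addr0 mulr0 expR0.
  by rewrite (integral_cst _ _ 1)// mul1e.
apply: le_trans (lne_scale_le x0 _ PA) _; first exact: measure_ge0.
rewrite lee_fin ler_pdivrMr//.
have : K / e <= x by near: x; apply: nbhs_pinfty_ge; exact: num_real.
rewrite ler_pdivrMr// => Kx.
by rewrite -subr_ge0 (_ : _ - _ = x * e - K) ?subr_ge0//; ring.
Unshelve. all: by end_near. Qed.

(** The exponential moment of order [x a] is split between the event that the
    pair is in a small ball around [w0] and its complement. The complement
    carries an exponentially small share of it, because [w0] is the only point
    where the tangent at [a] can touch [Lambda^*]. On the ball the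
    density is at most [exp (x (<a, w0> + h/2))]. *)
Lemma open_lower_bound (O : set (R * R)) (w0 : R * R) (h : R) : open O -> O w0 ->
  exposed_points (conjugate (Lambda f)) w0 -> 0 < h ->
  \forall x \near +oo,
    (- conjugate (Lambda f) w0 - h%:E <=
      (x^-1)%:E * lne (P [set w | O (Z x w)]))%E.
Proof.
have exponent_half (K k r x L e c : R) : x * L - k <= r ->
  K + k + c <= x * e -> K + x * (L - e) <= r - c by lra.
have half_le (u v : R) : u <= v + u / 2 -> u / 2 <= v by lra.
have exponent_final (k r x L D c : R) : x * L - k <= r ->
  k + c <= x * (h / 2) -> (- (D - L) - h) * x <= r - c - x * (D + h / 2) by lra.
move=> oO Ow0 [a exp_a] h0.
have ca : core f a by exact: (exposing_core f_nd f_gtNy f0 exp_a).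
have La : (conjugate (Lambda f) w0 >= (dotp a w0 - Lam a)%:E)%E.
  rewrite EFinB fineK; last exact: core_fin f_nd f_gtNy _ ca.
  exact: conjugate_ge.
have [e1 e10 ball_O] := nbhs_prodR (open_nbhs_nbhs (conj oO Ow0)).
pose na : R := `|a.1| + `|a.2|.
have na0 : 0 <= na by rewrite addr_ge0.
(* On the ball of radius [dl], [<a, z>] differs from [<a, w0>] by at most [h/2]. *)
pose dl : R := Num.min e1 (h / 2 / (na + 1)).
have dl0 : 0 < dl by rewrite lt_min e10 !divr_gt0//; lra.
have na_dl : na * dl <= h / 2.
  have : na * dl <= na * (h / 2 / (na + 1)).
    by rewrite ler_wpM2l// ge_min lexx orbT.
  move/le_trans; apply; rewrite mulrA ler_pdivrMr; last lra.
  by rewrite [leLHS]mulrC ler_wpM2l; lra.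
pose B := [set z : R * R | `|w0.1 - z.1| < dl /\ `|w0.2 - z.2| < dl].
have BO : B `<=` O.
  move=> z [z1 z2]; apply: ball_O.
    by apply: lt_le_trans z1 _; rewrite ge_min lexx.
  by apply: lt_le_trans z2 _; rewrite ge_min lexx.
have oB : open B.
  exact: (ball_open (w0 : R * R) dl).
have [] := @tilted_closed_bound a 0 (~` B) ca (open_closedC oB).
  move=> z nBz.
  have zw : z <> w0.
    by move=> zw; apply: nBz; rewrite zw /B/= !subrr normr0.
  have [b cb gb] := conjugate_gt_core f_nd f_gtNy f0
    (conjugate_gt_tangent f_nd f_gtNy f0 (exp_a z zw) ca).
  by exists b => //; rewrite /gain subr_gt0.
move=> K [e [e0 bound]].
have [k kb] := mgf_scaled_pair T_gt0 T_indep T_ident ca.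
near=> x.
have x0 : 0 < x by near: x; apply: nbhs_pinfty_gt; exact: num_real.
have mB := measurable_event_open x0 oB.
set A := [set w | B (Z x w)] in mB.
have mt := measurable_tilt a x0.
have [r rk Er] := kb x x0.
have split_r : ((expR r)%:E <= (expR (x * (dotp a w0 + h / 2)))%:E * P A +
    (expR (K + x * (Lam a - e)))%:E)%E.
  rewrite -Er -(setUv A) ge0_integral_setU//; last 3 first.
  - exact: measurableC.
  - exact: measurable_funTS.
  - exact/disj_setPCl.
  apply: leeD; last first.
    by have := bound x x0; rewrite add0r.
  rewrite -(integral_cst P mB) /=; apply: ge0_le_integral => //.
  - exact: measurable_funTS.
  - move=> w [w1 w2]; rewrite lee_fin ler_expR ler_pM2l//.
    apply: le_trans (dotp_near a w1 w2) _.
    by rewrite lerD2l.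
have rk' : x * Lam a - k <= r.
  by move: rk; rewrite ler_norml => /andP[]; rewrite lerBrDr addrC.
(* For large [x] the complement carries at most half of the moment. *)
have half : expR (K + x * (Lam a - e)) <= expR r / 2.
  rewrite -[2]lnK ?posrE// -expRN -expRD ler_expR.
  have : (K + k + ln 2) / e <= x.
    by near: x; apply: nbhs_pinfty_ge; exact: num_real.
  rewrite ler_pdivrMr//; exact: exponent_half rk'.
have Pfin : P A \is a fin_num by exact: fin_num_measure.
have PA : ((expR (r - ln 2 - x * (dotp a w0 + h / 2)))%:E <= P A)%E.
  move: split_r; rewrite -(fineK Pfin) -EFinM -EFinD !lee_fin => split_r.
  rewrite expRD expRN ler_pdivrMr ?expR_gt0// expRD expRN lnK ?posrE//.
  have : expR r <= expR (x * (dotp a w0 + h / 2)) * fine (P A) + expR r / 2.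
    by apply: le_trans split_r _; rewrite lerD2l.
  by rewrite mulrC; exact: half_le.
have PO : (P A <= P [set w | O (Z x w)])%E.
  apply: le_measure; rewrite ?inE//; first exact: measurable_event_open.
  by move=> w; exact: BO.
apply: le_trans (lne_scale_ge x0 (le_trans PA PO)).
apply: (@le_trans _ _ (- (dotp a w0 - Lam a)%:E - h%:E)%E).
  by apply: leeB => //; rewrite leeN2.
rewrite -EFinN -EFinB lee_fin ler_pdivlMr//.
have : (k + ln 2) / (h / 2) <= x.
  by near: x; apply: nbhs_pinfty_ge; exact: num_real.
rewrite ler_pdivrMr ?divr_gt0//; exact: exponent_final rk'.
Unshelve. all: by end_near. Qed.

End large_deviations.

Theorem proposition3p1 (R : realType) (d : measure_display)
    (Omega : measurableType d) (P : probability Omega R)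
    (T : nat -> {RV P >-> R})
    (T_gt0 : forall n w, 0 < T n w)
    (T_indep : mutually_independent P T)
    (T_ident : identically_distributed P T)
    (D0 : interior (effective_domain (phi P (T 0%N))) 0) :
  let L : R * R -> \bar R := Lambda (phi P (T 0%N)) in
  let J : R * R -> \bar R := conjugate L in
  let logprob (B : set (R * R)) (x : R) : \bar R :=
    ((x^-1)%:E * lne (P [set w | B (scaled_pair T x w)]))%E in
  [/\ (\forall a \near ((0, 0) : R * R), L a \is a fin_num),
      (forall C : set (R * R), closed C ->
        (limf_esup (logprob C) (pinfty_nbhs R) <= - ereal_inf (J @` C))%E) &
      (forall O : set (R * R), open O ->
        (- ereal_inf (J @` (O `&` exposed_points J)) <=
           limf_einf (logprob O) (pinfty_nbhs R))%E)].
Proof.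
move=> L J logprob.
have f_nd := phi_nd (T_gt0 0%N).
have f_gtNy := @phi_gtNy _ _ _ P (T 0%N).
have [e e0 De] : exists2 e : R, 0 < e & forall s, `|s| < e ->
    effective_domain (phi P (T 0%N)) s.
  move: D0 => /nbhs_ballP[e /= e0 eD]; exists e => // s se; apply: eD.
  by rewrite /ball/= sub0r normrN.
have below_small s : `|s| < e -> below_domain (phi P (T 0%N)) s.
  rewrite ltr_norml => /andP[s1 s2]; exists ((s + e) / 2); first lra.
  by apply: De; rewrite ltr_norml; apply/andP; split; lra.
have f0 : below_domain (phi P (T 0%N)) 0 by apply: below_small; rewrite normr0.
split.
- apply/nbhs_ballP; exists (e / 2) => /=; first by rewrite divr_gt0.
  move=> a [/= a1 a2]; apply: (core_fin f_nd f_gtNy).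
  move: a1 a2; rewrite /ball/= !sub0r !normrN => a1 a2.
  split; apply: below_small; first by apply: lt_trans a1 _; lra.
  by apply: le_lt_trans (ler_normD _ _) _; lra.
- move=> C cC; rewrite leNgt; apply/negP => lt_sup.
  (* A real strictly between the two sides turns a possibly infinite infimum
   into a uniform rate over [C]. *)
have [l l1 l2] := real_between lt_sup.
  have : (limf_esup (logprob C) (pinfty_nbhs R) <= l%:E)%E.
    apply: limf_esup_le; rewrite -(opprK l).
    apply: (closed_upper_bound T_gt0 T_indep T_ident f0 cC) => z Cz.
    rewrite EFinN lteNl; apply: le_lt_trans l1.
    by rewrite leeN2; apply: ereal_inf_lbound; exists z.
  by rewrite leNgt l2.
- move=> O oO; rewrite leeNl; apply: le_ereal_inf_tmp => _ [w [Ow expw] <-].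
  rewrite leeNl; apply/lee_subgt0Pr => h h0.
  apply: limf_einf_ge.
  exact: (open_lower_bound T_gt0 T_indep T_ident f0 oO Ow expw h0).
Qed.
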